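(* For any stationary policy $f\in\Phi$, the function $U(f)$ is the unique solution $v\in\widehat{\mathcal M}$ of the Koopmans equation $$v(s)=\left[(1-\beta)u(s,f(s))^p+\beta\left(\frac1r\ln\int_S e^{rv(s')}q(ds'|s,f(s))\right)^p\right]^{1/p}\quad\text{for all } s\in S.$$
   Context: Model. $S$ (states) and $A$ (actions) are Borel spaces, i.e. non-empty Borel subsets of complete separable metric spaces. $\mathbb K\subset S\times A$ is a non-empty Borel set such that each section $A(s)=\{a\in A:(s,a)\in\mathbb K\}$, $s\in S$, is non-empty. $q$ is a Borel measurable transition probability from $\mathbb K$ to $S$. $u:\mathbb K\to\mathbb R$ is Borel measurable with $b_0\le u(s,a)\le b_1$ for all $(s,a)\in\mathbb K$, where $b_1>b_0>0$ are constants. $\beta\in[0,1)$, $r<0$, and $p<1$, $p\ne0$ are fixed real parameters. $\Phi$ is the set of all Borel measurable $f:S\to A$ with $f(s)\in A(s)$ for all $s\in S$; elements of $\Phi$ are identified with stationary policies. Constants. $0<\epsilon<B$ are fixed constants chosen as follows: if $p<0$, then $\epsilon\le b_0$ and $B\ge(1-\beta)^{1/p}b_1$; if $p\in(0,1)$, then $\epsilon\le(1-\beta)^{1/p}b_0$ and $B\ge b_1$. $\widehat{\mathcal M}$ is the set of all Borel measurable functions $v:S\to[\epsilon,B]$. Recursive utility of a stationary policy $f\in\Phi$. Put $U_1(f)(s)=(1-\beta)^{1/p}u(s,f(s))$ and, for $n\ge1$, $$U_{n+1}(f)(s)=\left[(1-\beta)u(s,f(s))^p+\beta\left(\frac1r\ln\int_S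 e^{rU_n(f)(s')}q(ds'|s,f(s))\right)^p\right]^{1/p},\quad s\in S.$$ Then $U(f)(s):=\lim_{n\to\infty}U_n(f)(s)$ for $s\in S$ (the sequence is monotone and bounded, so the limit exists). *)

(* Defs.v *)
From HB Require Import structures.
From mathcomp Require Import all_boot all_order all_algebra.
From mathcomp Require Import all_classical all_reals all_analysis.
From mathcomp Require Import measurable_realfun.
Import Order.TTheory GRing.Theory Num.Theory.
Import numFieldNormedType.Exports.

Set Implicit Arguments.
Unset Strict Implicit.
Unset Printing Implicit Defensive.

Local Open Scope classical_set_scope.
Local Open Scope ring_scope.

Definition complete_metric (R : realType) (X : metricType R) : Prop :=
  forall x : nat -> X, cauchy (x @ \oo) -> exists l : X, x @ \oo --> l.

Definition separable_metric (R : realType) (X : metricType R) : Prop :=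
  exists2 D : set X, countable D & dense D.

(* A Borel subset of a complete separable metric space [X], with its trace
   Borel sigma-algebra, is presented as a measurable type [T] together with the
   inclusion [i : T -> X].  Non-emptiness is automatic because every
   [measurableType] is pointed. *)
Definition borel_space (R : realType) (d : measure_display)
    (T : measurableType d) : Prop :=
  exists (X : metricType R) (i : T -> X),
    [/\ complete_metric X, separable_metric X, injective i,
        <<s @open X >> (range i) &
        d.-measurable = preimage_set_system [set: T] i <<s @open X >>].

Section recursive_utility.
Context {R : realType} {dS dA : measure_display}.
Context {S : measurableType dS} {A : measurableType dA}.

(* [q], like the utility [u] below, is a total function, but only its values
   on [K] are constrained or used. *)
Definition transition_probability (K : set (S * A))
    (q : S * A -> probability S R) : Prop :=
  forall B : set S, measurable B -> measurable_fun K (fun k => q k B).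

(* [xsection K s] is the set A(s) of actions admissible in state [s]. *)
Definition stationary_policies (K : set (S * A)) : set (S -> A) :=
  [set f | measurable_fun [set: S] f /\ forall s, xsection K s (f s)].

Definition bounded_utilities (eps B : R) : set (S -> R) :=
  [set v | measurable_fun [set: S] v /\ forall s, eps <= v s <= B].

Variables (q : S * A -> probability S R) (u : S * A -> R) (beta r p : R).

Definition koopmans (f : S -> A) (v : S -> R) (s : S) : R :=
  ((1 - beta) * u (s, f s) `^ p +
   beta * (r^-1 * ln (\int[q (s, f s)]_s' expR (r * v s'))) `^ p) `^ p^-1.

(* The index is shifted: [utility_iter f n] is U_{n+1}(f). *)
Fixpoint utility_iter (f : S -> A) (n : nat) : S -> R :=
  if n is m.+1 then koopmans f (utility_iter f m)
  else fun s => (1 - beta) `^ p^-1 * u (s, f s).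

(* [limn] returns 0 on a divergent sequence, so asserting that a value of
   [recursive_utility f] is positive entails that the limit exists. *)
Definition recursive_utility (f : S -> A) (s : S) : R :=
  limn (fun n => utility_iter f n s).

End recursive_utility.

(* Main.v *)
(* The certainty equivalent M v = (1/r) ln (\int e^{r v} dq) is monotone and, by
   Jensen, satisfies M (l v) >= l * M v for l in [0, 1].  The utilities U_n are
   monotone in n, so dominated convergence makes their limit a fixed point of
   the Koopmans operator T.  For uniqueness, let v = T v, w = T w and let L <= 1
   be the largest constant with L w <= v.  If L < 1, applying T to L w <= v
   yields L' w <= v with L' > L, because the current utility makes up at least
   a fixed positive share of w^p and is not shrunk by L. *)

Require Import Defs.
From HB Require Import structures.
From mathcomp Require Import all_boot all_order all_algebra.
From mathcomp Require Import all_classical all_reals all_analysis.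
From mathcomp Require Import measurable_realfun.
From mathcomp Require Import ring lra.
Import Order.TTheory GRing.Theory Num.Theory.
Import numFieldNormedType.Exports.

Local Open Scope classical_set_scope.
Local Open Scope ring_scope.

(** Convexity of exp between 0 and [y]: the tangent at [l * y] lies below exp at both endpoints, and
    the two inequalities are averaged with weights [1 - l] and [l]. *)
Lemma expR_mul_le (R : realType) (l y : R) :
  0 <= l <= 1 -> expR (l * y) <= 1 - l + l * expR y.
Proof.
move=> /andP[l0 l1].
have h1 : expR (l * y) * (1 + (1 - l) * y) <= expR y.
  have -> : expR y = expR (l * y) * expR ((1 - l) * y).
    by rewrite -expRD; congr expR; ring.
  by rewrite ler_pM2l ?expR_gt0 ?expR_ge1Dx.
have h2 : expR (l * y) * (1 - l * y) <= 1.
  rewrite -[leRHS]expR0 -[X in _ <= expR X](subrr (l * y)) expRD.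
  by rewrite ler_pM2l ?expR_gt0 ?expR_ge1Dx.
have := lerD (ler_wpM2l l0 h1) (ler_wpM2l (ltac:(lra) : 0 <= 1 - l) h2).
by lra.
Qed.

(** * Powers of positive reals with an exponent of either sign *)

Section powR_signed.
Context {R : realType}.
Implicit Types a p x y : R.

Lemma powR1r p : 1 `^ p = 1 :> R.
Proof. by rewrite powR1. Qed.

Lemma powRK_inv p x : p != 0 -> 0 <= x -> (x `^ p) `^ p^-1 = x.
Proof. by move=> p0 x0; rewrite -powRrM mulfV// powRr1. Qed.

Lemma powR_invK p x : p != 0 -> 0 <= x -> (x `^ p^-1) `^ p = x.
Proof. by move=> p0 x0; rewrite -powRrM mulVf// powRr1. Qed.

Lemma ler_pos_powR p : 0 < p -> {in Num.pos &, {mono @powR R ^~ p : x y / x <= y}}.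
Proof.
move=> p0; apply: (@le_mono_in _ _ _ _ Num.pos) => x y x0 y0 xy.
by apply: gt0_ltr_powR => //; rewrite nnegrE ltW.
Qed.

(** Positivity of the arguments matters: [powR] sends 0 to 0 for [p != 0], which breaks the reversal
    of the order. *)
Lemma ler_neg_powR p : p < 0 -> {in Num.pos &, {mono @powR R ^~ p : x y /~ x <= y}}.
Proof.
move=> p0 x y x0 y0; rewrite -[p]opprK !(powRN _ (- p)) lef_pV2 ?posrE ?powR_gt0//.
by rewrite ler_pos_powR// oppr_gt0.
Qed.

Lemma ltr_pos_powR p : 0 < p -> {in Num.pos &, {mono @powR R ^~ p : x y / x < y}}.
Proof. by move=> p0; exact: leW_mono_in (ler_pos_powR p p0). Qed.

Lemma ltr_neg_powR p : p < 0 -> {in Num.pos &, {mono @powR R ^~ p : x y /~ x < y}}.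
Proof. by move=> p0; exact: leW_nmono_in (ler_neg_powR p p0). Qed.

Lemma le_powR_neg {p} x y : p < 0 -> 0 < x -> 0 < y ->
  y <= x -> x `^ p <= y `^ p.
Proof. by move=> p0 x0 y0; rewrite ler_neg_powR. Qed.

Lemma le_powR_pos {p} x y : 0 < p -> 0 < x -> 0 < y ->
  x <= y -> x `^ p <= y `^ p.
Proof. by move=> p0 x0 y0; rewrite ler_pos_powR. Qed.

Lemma cvg_powR p a (x : R^nat) : 0 < a -> x @ \oo --> a ->
  (fun n => x n `^ p) @ \oo --> a `^ p.
Proof.
move=> a0 xa; apply: (@continuous_cvg _ _ _ _ _ _ (@powR R ^~ p)) => //.
apply/differentiable_continuous/derivable1_diffP/derivable_powR.
by rewrite in_itv/= a0.
Qed.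

End powR_signed.

(** * Certainty equivalent of a bounded utility *)

Definition certainty_equivalent {R : realType} {d} {S : measurableType d}
  (r : R) (P : probability S R) (v : S -> R) : R :=
  r^-1 * ln (\int[P]_s expR (r * v s)).

Section certainty_equivalent.
Context {R : realType} {d} {S : measurableType d}.
Variables (r : R) (P : probability S R).
Hypothesis r_lt0 : r < 0.
Local Notation ce := (certainty_equivalent r P).

Lemma measurable_expR_utility (v : S -> R) : measurable_fun [set: S] v ->
  measurable_fun [set: S] (fun s => expR (r * v s)).
Proof.
by move=> mv; apply: measurableT_comp => //; apply: measurable_funM.
Qed.

Lemma expR_utility_bounds a b v (s : S) : bounded_utilities a b v ->
  expR (r * b) <= expR (r * v s) <= expR (r * a).
Proof.
by move=> [_ /(_ s)/andP[av vb]]; rewrite !ler_expR !ler_nM2l// av vb.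
Qed.

Lemma integrable_expR_utility a b v : bounded_utilities a b v ->
  P.-integrable [set: S] (EFin \o (fun s => expR (r * v s))).
Proof.
move=> bv; apply: measurable_bounded_integrable => //.
- by rewrite -ge0_fin_numE// fin_num_measure.
- exact: measurable_expR_utility bv.1.
- exists (expR (r * a)); split; rewrite ?num_real// => x ax s _ /=.
  rewrite ger0_norm ?expR_ge0//; apply: le_trans (ltW ax).
  by have /andP[] := expR_utility_bounds _ _ _ s bv.
Qed.

Lemma Rintegral_prob_cst (c : R) : \int[P]_s c = c.
Proof. by rewrite Rintegral_cst//= probability_setT mulr1. Qed.

Lemma integrable_prob_cst (c : R) : P.-integrable [set: S] (EFin \o (fun=> c)).
Proof. by apply: finite_measure_integrable_cst. Qed.

Lemma Rintegral_expR_bounds a b v : bounded_utilities a b v ->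
  expR (r * b) <= \int[P]_s expR (r * v s) <= expR (r * a).
Proof.
move=> bv; rewrite -(Rintegral_prob_cst (expR (r * b))).
rewrite -(Rintegral_prob_cst (expR (r * a))).
apply/andP; split; apply: le_Rintegral => //;
  try exact: integrable_prob_cst; try exact: integrable_expR_utility bv;
  by move=> s _; have /andP[] := expR_utility_bounds _ _ _ s bv.
Qed.

Lemma Rintegral_expR_gt0 a b v : bounded_utilities a b v ->
  0 < \int[P]_s expR (r * v s).
Proof.
move=> /Rintegral_expR_bounds/andP[+ _]; exact/lt_le_trans/expR_gt0.
Qed.

(** A constant is its own certainty equivalent, and the order reversals of [expR (r * _)] and of
    [r^-1 * ln _] cancel. *)
Lemma certainty_equivalent_bounds a b v : bounded_utilities a b v ->
  a <= ce v <= b.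
Proof.
move=> bv; have I0 := Rintegral_expR_gt0 _ _ _ bv.
have /andP[h1 h2] := Rintegral_expR_bounds _ _ _ bv.
have rn0 : r != 0 by rewrite lt_eqF.
have cst c : c = r^-1 * ln (expR (r * c)) by rewrite expRK mulKf.
rewrite /certainty_equivalent [X in X <= _ <= _]cst [X in _ <= _ <= X]cst.
by rewrite !ler_nM2l ?invr_lt0// !ler_ln ?posrE ?expR_gt0// h1 h2.
Qed.

(** The two functions have separate bounds because one of them will be a scaled utility [l * w],
    whose values may leave the common range. *)
Lemma le_certainty_equivalent a b a' b' v w : bounded_utilities a b v ->
  bounded_utilities a' b' w -> (forall s, v s <= w s) -> ce v <= ce w.
Proof.
move=> bv bw vw; rewrite /certainty_equivalent ler_nM2l ?invr_lt0//.
rewrite ler_ln ?posrE; last 2 first.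
- exact: Rintegral_expR_gt0 bw.
- exact: Rintegral_expR_gt0 bv.
apply: le_Rintegral => //; [exact: integrable_expR_utility bw|
  exact: integrable_expR_utility bv|].
by move=> s _; rewrite ler_expR ler_nM2l.
Qed.

Lemma bounded_utilitiesZ l a b (v : S -> R) : 0 <= l -> bounded_utilities a b v ->
  bounded_utilities (l * a) (l * b) (fun s => l * v s).
Proof.
move=> l0 [mv bv]; split; first exact: measurable_funM.
by move=> s; have /andP[av vb] := bv s; rewrite !ler_wpM2l.
Qed.

(* Jensen for [x |-> x ^ l], whose tangent at the mean [m = \int X] gives
   [X ^ l <= m ^ l * (1 - l + l * X / m)]. *)
Lemma certainty_equivalentZ_ge l a b v : 0 <= l <= 1 ->
  bounded_utilities a b v -> l * ce v <= ce (fun s => l * v s).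
Proof.
move=> l01 bv; have /andP[l0 l1] := l01.
have bw := bounded_utilitiesZ _ _ _ _ l0 bv.
have m0 := Rintegral_expR_gt0 _ _ _ bv.
have I0 := Rintegral_expR_gt0 _ _ _ bw.
rewrite /certainty_equivalent mulrCA ler_nM2l ?invr_lt0//.
set m := \int[P]_s expR (r * v s) in m0 *.
have -> : l * ln m = ln (expR (l * ln m)) by rewrite expRK.
rewrite ler_ln ?posrE ?expR_gt0//.
pose c := expR (l * ln m).
(* The tangent line has mean exactly [c], because [expR (r * v s) / m] has mean 1; a pointwise
   comparison then suffices. *)
have -> : expR (l * ln m) = \int[P]_s (c * (1 - l) + c * l / m * expR (r * v s)).
  rewrite RintegralD//; last 2 first.
  - exact: integrable_prob_cst.
  - by apply: (integrableZl _ _ (integrable_expR_utility _ _ _ bv)).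
  rewrite Rintegral_prob_cst RintegralZl//; last exact: integrable_expR_utility bv.
  by rewrite -/m mulfVK ?gt_eqF// /c; ring.
apply: le_Rintegral => //.
- exact: integrable_expR_utility bw.
- have -> : (EFin \o (fun s => c * (1 - l) + c * l / m * expR (r * v s))) =
      ((EFin \o fun=> (c * (1 - l))%R) \+
       (fun s => (c * l / m)%:E * (EFin \o (fun s => expR (r * v s))) s))%E.
    by apply/funext.
  apply: integrableD => //; first exact: integrable_prob_cst.
  by apply: (integrableZl _ _ (integrable_expR_utility _ _ _ bv)).
move=> s _.
have -> : r * (l * v s) = l * ln m + l * (r * v s - ln m) by ring.
rewrite expRD -/c.
have -> : c * (1 - l) + c * l / m * expR (r * v s) =
          c * (1 - l + l * expR (r * v s - ln m)).
  by rewrite expRD expRN lnK ?posrE//; ring.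
by rewrite ler_pM2l ?expR_gt0// expR_mul_le.
Qed.

(** Dominated convergence with the constant [expR (r * a)]: as [r < 0], the lower bound [a] gives
    the majorant. The limit integral is positive, so [ln] is continuous there. *)
Lemma cvg_certainty_equivalent a b (v : (S -> R)^nat) w :
  (forall n, bounded_utilities a b (v n)) -> bounded_utilities a b w ->
  (forall s, v ^~ s @ \oo --> w s) ->
  (fun n => ce (v n)) @ \oo --> ce w.
Proof.
move=> bv bw vw; apply: cvgMl_tmp.
apply: continuous_cvg; first exact: continuous_ln (Rintegral_expR_gt0 _ _ _ bw).
apply: fine_cvg; rewrite fineK; last first.
  by apply: integrable_fin_num => //; exact: integrable_expR_utility bw.
have [] := @dominated_convergence _ _ _ P [set: S] measurableT
  (fun n s => (expR (r * v n s))%:E) (fun s => (expR (r * w s))%:E)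
  (fun=> (expR (r * a))%:E) => //.
- move=> n; apply/measurable_EFinP; exact: measurable_expR_utility (bv n).1.
- by apply/measurable_EFinP; exact: measurable_expR_utility bw.1.
- apply: nearW => s _; apply: cvg_EFin; first exact: nearW.
  apply: continuous_cvg; first exact: continuous_expR.
  exact: cvgMl_tmp.
- exact: integrable_prob_cst.
- apply: nearW => s n _; rewrite lee_fin ger0_norm ?expR_ge0//.
  by have /andP[] := expR_utility_bounds _ _ _ s (bv n).
Qed.

End certainty_equivalent.

(** * Measurability in the state *)

Lemma measurable_certainty_equivalent {R : realType} {d} {S : measurableType d}
    (r : R) (Q : S -> probability S R) (v : S -> R) :
  (forall E, measurable E -> measurable_fun [set: S] (fun s => Q s E)) ->
  measurable_fun [set: S] v ->
  measurable_fun [set: S] (fun s => certainty_equivalent r (Q s) v).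
Proof.
move=> mQ mv; apply: measurable_funM => //; apply: measurableT_comp => //.
apply: measurableT_comp => //; apply: (measurable_fun_integral_kernel mQ) => //.
by apply/measurable_EFinP; exact: measurable_expR_utility.
Qed.

(** Serves to transfer the measurability of [q] and [u], known only on [K], to their compositions
    with a policy. *)
Lemma measurable_fun_graph {d1 d2 d3} {S : measurableType d1}
    {A : measurableType d2} {T : measurableType d3} (K : set (S * A))
    (f : S -> A) (g : S * A -> T) :
  measurable K -> measurable_fun [set: S] f ->
  (forall s, K (s, f s)) -> measurable_fun K g ->
  measurable_fun [set: S] (fun s => g (s, f s)).
Proof.
move=> mK mf Kf mg; apply: (measurable_comp mK _ mg).
  by move=> _ [s _ <-]; exact: Kf.
exact: measurable_fun_pair.
Qed.

(** * The Koopmans operator of a fixed policy *)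

Section koopmans.
Context {R : realType} {dS dA : measure_display}.
Context {S : measurableType dS} {A : measurableType dA}.
Variables (q : S * A -> probability S R) (u : S * A -> R) (beta r p : R).
Variables (f : S -> A) (b0 b1 eps B : R).
Hypotheses (beta_bnd : 0 <= beta < 1) (r_lt0 : r < 0) (p_neq0 : p != 0).
Hypotheses (b0_gt0 : 0 < b0) (eps_gt0 : 0 < eps) (B_gt0 : 0 < B).
Hypothesis mq : forall E, measurable E ->
  measurable_fun [set: S] (fun s => q (s, f s) E).
Hypothesis mu : measurable_fun [set: S] (fun s => u (s, f s)).
Hypothesis u_bnd : forall s, b0 <= u (s, f s) <= b1.
Hypothesis bnd_neg : p < 0 -> eps <= b0 /\ (1 - beta) `^ p^-1 * b1 <= B.
Hypothesis bnd_pos : 0 < p -> eps <= (1 - beta) `^ p^-1 * b0 /\ b1 <= B.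

Local Notation bu := (@bounded_utilities R dS S eps B).
Local Notation T := (koopmans q u beta r p f).
Local Notation iter := (utility_iter q u beta r p f).
Local Notation ce s := (certainty_equivalent r (q (s, f s))).
Local Notation C s := ((1 - beta) * u (s, f s) `^ p).
Local Notation G v s := (C s + beta * ce s v `^ p).

Let beta_ge0 : 0 <= beta. Proof. by case/andP: beta_bnd. Qed.

Let omb_gt0 : 0 < 1 - beta. Proof. by case/andP: beta_bnd; rewrite subr_gt0. Qed.

Let u_gt0 s : 0 < u (s, f s).
Proof. by case/andP: (u_bnd s) => + _; exact: lt_le_trans. Qed.

Let C_gt0 s : 0 < C s.
Proof. by rewrite mulr_gt0// powR_gt0. Qed.

Let G_gt0 v s : 0 < G v s.
Proof. by rewrite ltr_wpDr// mulr_ge0// powR_ge0. Qed.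

Let bu_gt0 v s : bu v -> 0 < v s.
Proof. by move=> [_ /(_ s)/andP[+ _]]; exact: lt_le_trans. Qed.

Let ce_bnd v s : bu v -> eps <= ce s v <= B.
Proof. exact: certainty_equivalent_bounds. Qed.

Let ce_gt0 v s : bu v -> 0 < ce s v.
Proof. by move=> /(ce_bnd _ s)/andP[+ _]; exact: lt_le_trans. Qed.

Let p_sign : p < 0 \/ 0 < p.
Proof. by case: ltgtP p_neq0 => //; auto. Qed.

Let pK x : 0 < x -> (x `^ p) `^ p^-1 = x.
Proof. by move=> x0; rewrite powRK_inv// ltW. Qed.

Let scale_powR b : 0 < b -> (1 - beta) `^ p^-1 * b = ((1 - beta) * b `^ p) `^ p^-1.
Proof. by move=> b0'; rewrite powRM ?pK ?powR_ge0// ltW. Qed.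

(** In the power [p] the fixed point equation is additive: current utility plus continuation. *)
Let koopmans_powR v s : T v s `^ p = G v s.
Proof. exact/powR_invK/ltW/G_gt0. Qed.

Lemma measurable_koopmans v : measurable_fun [set: S] v ->
  measurable_fun [set: S] (T v).
Proof.
move=> mv; apply: (measurableT_comp (measurable_powR _)).
apply: measurable_funD; apply: measurable_funM => //;
  apply: (measurableT_comp (measurable_powR _)) => //.
exact: (measurable_certainty_equivalent _ (fun s => q (s, f s))).
Qed.

Let le_powRV_neg x y : p < 0 -> 0 < x -> 0 < y ->
  y <= x -> x `^ p^-1 <= y `^ p^-1.
Proof. by move=> pn; apply: le_powR_neg; rewrite invr_lt0. Qed.

Let le_powRV_pos x y : 0 < p -> 0 < x -> 0 < y ->
  x <= y -> x `^ p^-1 <= y `^ p^-1.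
Proof. by move=> pn; apply: le_powR_pos; rewrite invr_gt0. Qed.

Let b1_gt0 : 0 < b1.
Proof. by have /andP[h1 h2] := u_bnd point; exact: lt_le_trans (le_trans h1 h2). Qed.

(** One bound comes from dropping the [beta] term: the upper one for [p < 0], where the outer power
    is decreasing, the lower one for [p > 0]. For the other bound, [u] and the certainty equivalent
    lie on the same side of [eps] (resp. [B]), hence so does their weighted power mean. *)
Lemma koopmans_bounded v : bu v -> bu (T v).
Proof.
move=> bv; split; first exact: measurable_koopmans bv.1.
move=> s; have /andP[ce1 ce2] := ce_bnd _ s bv; have /andP[u1 u2] := u_bnd s.
have ce0 := ce_gt0 _ s bv; have u0 := u_gt0 s; have C0 := C_gt0 s.
have D0 : 0 <= beta * ce s v `^ p by rewrite mulr_ge0// powR_ge0.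
rewrite /koopmans -/(certainty_equivalent _ _ _).
case: p_sign => p0.
- have [h1 h2] := bnd_neg p0; apply/andP; split.
  + rewrite -[leLHS]pK//; apply: le_powRV_neg; rewrite ?powR_gt0//.
    have e1 : ce s v `^ p <= eps `^ p by exact: le_powR_neg.
    have e2 : u (s, f s) `^ p <= eps `^ p.
      by apply: le_powR_neg => //; exact: le_trans u1.
    have := lerD (ler_wpM2l (ltW omb_gt0) e2) (ler_wpM2l beta_ge0 e1).
    by move=> /le_trans; apply; lra.
  + apply: le_trans h2; rewrite scale_powR//.
    apply: le_powRV_neg; rewrite ?mulr_gt0 ?powR_gt0//.
    have := ler_wpM2l (ltW omb_gt0) (le_powR_neg _ _ p0 b1_gt0 u0 u2); lra.
- have [h1 h2] := bnd_pos p0; apply/andP; split.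
  + apply: le_trans h1 _; rewrite scale_powR//.
    apply: le_powRV_pos; rewrite ?mulr_gt0 ?powR_gt0//.
    have := ler_wpM2l (ltW omb_gt0) (le_powR_pos _ _ p0 b0_gt0 u0 u1); lra.
  + rewrite -[leRHS]pK//; apply: le_powRV_pos; rewrite ?powR_gt0//.
    have e1 : ce s v `^ p <= B `^ p by exact: le_powR_pos.
    have e2 : u (s, f s) `^ p <= B `^ p.
      by apply: le_powR_pos => //; exact: le_trans h2.
    have := lerD (ler_wpM2l (ltW omb_gt0) e2) (ler_wpM2l beta_ge0 e1).
    by move=> /le_trans; apply; lra.
Qed.

(** For [p < 0] the inner and the outer power both reverse the order, so the operator is monotone
    for either sign. *)
Lemma le_koopmans v w : bu v -> bu w -> (forall s, v s <= w s) ->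
  forall s, T v s <= T w s.
Proof.
move=> bv bw vw s.
have le_ce : ce s v <= ce s w.
  exact: (le_certainty_equivalent _ _ r_lt0 _ _ _ _ _ _ bv bw).
have [v0 w0] := (ce_gt0 _ s bv, ce_gt0 _ s bw).
case: p_sign => p0.
- apply: (le_powRV_neg _ _ p0 (G_gt0 v s) (G_gt0 w s)).
  move: (ce s v) (ce s w) le_ce v0 w0 => x y xy x0 y0.
  by rewrite lerD2l ler_wpM2l//; exact: le_powR_neg.
- apply: (le_powRV_pos _ _ p0 (G_gt0 v s) (G_gt0 w s)).
  move: (ce s v) (ce s w) le_ce v0 w0 => x y xy x0 y0.
  by rewrite lerD2l ler_wpM2l//; exact: le_powR_pos.
Qed.

(** Both powers are taken near positive limits, where they are continuous. *)
Lemma cvg_koopmans (v : (S -> R)^nat) w s :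
  (forall n, bu (v n)) -> bu w -> (forall s, v ^~ s @ \oo --> w s) ->
  (fun n => T (v n) s) @ \oo --> T w s.
Proof.
move=> bv bw vw; apply: cvg_powR; first exact: G_gt0.
apply: cvgD; first exact: cvg_cst.
apply: cvgMl_tmp; apply: cvg_powR; first exact: ce_gt0.
exact: cvg_certainty_equivalent bv bw vw.
Qed.

(** * Monotone convergence of the iterates *)

Lemma utility_iter_bounded n : bu (iter n).
Proof.
elim: n => [|n IHn]; last exact: koopmans_bounded.
split; first exact: measurable_funM.
move=> s; have /andP[u1 u2] := u_bnd s; have u0 := u_gt0 s => /=.
have k0 : 0 <= (1 - beta) `^ p^-1 by exact: powR_ge0.
(* Hence the factor in front of [u] is at least 1 for [p < 0] and at most 1 for [p > 0]. *)
have le1 : 1 - beta <= 1 by rewrite gerBl.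
case: p_sign => p0.
- have [h1 h2] := bnd_neg p0; apply/andP; split.
  + apply: (le_trans h1); apply: (le_trans u1); rewrite ler_peMl ?(ltW u0)//.
    by rewrite -[leLHS](powR1r p^-1); apply: le_powRV_neg.
  + by apply: le_trans h2; rewrite ler_wpM2l.
- have [h1 h2] := bnd_pos p0; apply/andP; split.
  + by apply: (le_trans h1); rewrite ler_wpM2l.
  + apply: le_trans h2; apply: le_trans u2; rewrite ler_piMl ?(ltW u0)//.
    by rewrite -[leRHS](powR1r p^-1); apply: le_powRV_pos.
Qed.

(** The first iterate is the Koopmans formula without its [beta] term; this starts both monotonicity
    inductions. *)
Lemma utility_iter0E s : iter 0 s = C s `^ p^-1.
Proof. exact: scale_powR. Qed.

Lemma nondecreasing_utility_iter s : 0 < p -> nondecreasing_seq (iter ^~ s).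
Proof.
move=> p0; apply/nondecreasing_seqP => n; elim: n s => [|n IHn] s.
  rewrite utility_iter0E.
  apply: (le_powRV_pos _ _ p0 (C_gt0 s) (G_gt0 (iter 0) s)).
  by rewrite lerDl mulr_ge0 ?powR_ge0.
exact: (le_koopmans _ _ (utility_iter_bounded n) (utility_iter_bounded n.+1) IHn).
Qed.

(** Here the nonnegative [beta] term lowers the first iterate, since the power [p^-1] is decreasing;
    monotonicity of the operator propagates this. *)
Lemma nonincreasing_utility_iter s : p < 0 -> nonincreasing_seq (iter ^~ s).
Proof.
move=> p0; apply/nonincreasing_seqP => n; elim: n s => [|n IHn] s.
  rewrite utility_iter0E.
  apply: (le_powRV_neg _ _ p0 (G_gt0 (iter 0) s) (C_gt0 s)).
  by rewrite lerDl mulr_ge0 ?powR_ge0.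
exact: (le_koopmans _ _ (utility_iter_bounded n.+1) (utility_iter_bounded n) IHn).
Qed.

Lemma cvg_utility_iter s :
  iter ^~ s @ \oo --> recursive_utility q u beta r p f s.
Proof.
have bi n := (utility_iter_bounded n).2 s.
case: p_sign => p0.
- apply: nonincreasing_is_cvgn; first exact: nonincreasing_utility_iter.
  by exists eps => _ [n _ <-]; have /andP[] := bi n.
- apply: nondecreasing_is_cvgn; first exact: nondecreasing_utility_iter.
  by exists B => _ [n _ <-]; have /andP[] := bi n.
Qed.

Lemma recursive_utility_bounded : bu (recursive_utility q u beta r p f).
Proof.
split.
  apply: (measurable_fun_cvg (h := iter)) => [n|s _].
    exact: (utility_iter_bounded n).1.
  exact: cvg_utility_iter.
move=> s; apply/andP; split.
- apply: (cvgr_to_ge (cvg_utility_iter s)).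
  by apply: nearW => n; have /andP[] := (utility_iter_bounded n).2 s.
- apply: (cvgr_to_le (cvg_utility_iter s)).
  by apply: nearW => n; have /andP[] := (utility_iter_bounded n).2 s.
Qed.

(** The shifted sequence has two limits, one as a tail of the iterates and one by continuity of the
    operator; they must agree. *)
Lemma recursive_utility_fixpoint s :
  recursive_utility q u beta r p f s = T (recursive_utility q u beta r p f) s.
Proof.
have h1 : (fun n => iter n.+1 s) @ \oo --> T (recursive_utility q u beta r p f) s.
  apply: cvg_koopmans.
  - exact: utility_iter_bounded.
  - exact: recursive_utility_bounded.
  - exact: cvg_utility_iter.
have h2 : (fun n => iter n.+1 s) @ \oo --> recursive_utility q u beta r p f s.
  by rewrite (cvg_shiftS (iter ^~ s)); exact: cvg_utility_iter.
exact: (cvg_unique _ h2 h1).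
Qed.

(** * Uniqueness of the fixed point *)

Lemma current_utility_share : exists2 k, 0 < k <= 1 &
  forall w s, bu w -> k * w s `^ p <= C s.
Proof.
(* A lower bound of [C s] over an upper bound of w ^ p; the sign of [p] decides which ends of the
   ranges give them. *)
pose k : R := if p < 0 then (1 - beta) * b1 `^ p / eps `^ p
  else (1 - beta) * b0 `^ p / B `^ p.
have k0 : 0 < k by rewrite /k; case: ifP => _; rewrite !mulr_gt0 ?invr_gt0 ?powR_gt0.
(* The cap at 1 will keep the improved ratio from exceeding 1. *)
exists (Num.min k 1); first by rewrite lt_min k0 ltr01 ge_min lexx orbT.
move=> w s bw; have w0 := bu_gt0 _ s bw; have u0 := u_gt0 s.
have /andP[w1 w2] := bw.2 s; have /andP[u1 u2] := u_bnd s.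
apply: (@le_trans _ _ (k * w s `^ p)).
  by rewrite ler_wpM2r ?powR_ge0// ge_min lexx.
rewrite /k; case: p_sign => p0.
- rewrite p0 mulrAC ler_pdivrMr ?powR_gt0//; apply: ler_pM;
    rewrite ?mulr_ge0 ?powR_ge0 ?(ltW omb_gt0)//; last exact: le_powR_neg.
  by rewrite ler_wpM2l ?(ltW omb_gt0)//; apply: le_powR_neg.
- rewrite ltNge (ltW p0)/= mulrAC ler_pdivrMr ?powR_gt0//; apply: ler_pM;
    rewrite ?mulr_ge0 ?powR_ge0 ?(ltW omb_gt0)//; last exact: le_powR_pos.
  by rewrite ler_wpM2l ?(ltW omb_gt0)//; apply: le_powR_pos.
Qed.

(* With [a = l ^ p], [l * w <= v] gives [G v <= a * G w + (1 - a) * C] or the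
   reverse according to the sign of [p], and [C] is at least a fixed share of
   [G w = w ^ p]. *)
Lemma improve_ratio v w l : bu v -> bu w -> v =1 T v -> w =1 T w ->
  0 < l < 1 -> (forall s, l * w s <= v s) ->
  exists2 l', l < l' <= 1 & forall s, l' * w s <= v s.
Proof.
move=> bv bw vT wT /andP[l0 l1] lwv.
have [k /andP[k0 k1] kC] := current_utility_share.
have le_ce s : l * ce s w <= ce s v.
  have l01 : 0 <= l <= 1 by rewrite !ltW.
  apply: le_trans (certainty_equivalentZ_ge _ _ r_lt0 _ _ _ _ l01 bw) _.
  apply: (le_certainty_equivalent _ _ r_lt0 _ _ _ _ _ _ _ bv) => //.
  by apply: bounded_utilitiesZ bw; exact: ltW.
have lceM s : (l * ce s w) `^ p = l `^ p * ce s w `^ p.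
  by rewrite powRM// ltW// ce_gt0.
(* [b] lies a share [k] of the way from [a] to 1; its power [p^-1] is the improved ratio. *)
pose a := l `^ p; pose b := a + (1 - a) * k.
have a0 : 0 < a by rewrite powR_gt0.
have b0' : 0 < b.
  rewrite /b; have -> : a + (1 - a) * k = a * (1 - k) + k by ring.
  by rewrite ltr_wpDl// mulr_ge0 ?subr_ge0// ltW.
have vp s : v s `^ p = G v s by rewrite vT koopmans_powR.
have wp s : w s `^ p = G w s by rewrite wT koopmans_powR.
have [v0 w0] := (fun s => bu_gt0 _ s bv, fun s => bu_gt0 _ s bw).
have lK : a `^ p^-1 = l by exact: pK.
have bw_pK s : b `^ p^-1 * w s = (b * w s `^ p) `^ p^-1.
  by rewrite powRM ?powR_ge0 ?pK// ltW.
have vpE s : v s `^ p = C s + beta * ce s v `^ p := vp s.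
have wpE s : w s `^ p = C s + beta * ce s w `^ p := wp s.
exists (b `^ p^-1).
  rewrite -{1}lK -[leRHS](powR1r p^-1).
  case: p_sign => p0.
  - have a1 : 1 < a by rewrite -(powR1r p) ltr_neg_powR ?posrE.
    have ba : b < a by rewrite /b gtrDl nmulr_rlt0// subr_lt0.
    have b1' : 1 <= b.
      have -> : b = 1 + (a - 1) * (1 - k) by rewrite /b; ring.
      by rewrite lerDl mulr_ge0 ?subr_ge0// ltW.
    by rewrite ltr_neg_powR ?ler_neg_powR ?posrE ?invr_lt0// ba.
  - have a1 : a < 1 by rewrite -(powR1r p) ltr_pos_powR ?posrE.
    have ab : a < b by rewrite /b ltrDl mulr_gt0// subr_gt0.
    have b1' : b <= 1.
      have -> : b = 1 - (1 - a) * (1 - k) by rewrite /b; ring.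
      by rewrite gerBl mulr_ge0 ?subr_ge0// ltW.
    by rewrite ltr_pos_powR ?ler_pos_powR ?posrE ?invr_gt0// ab.
move=> s; rewrite bw_pK -[leRHS]pK//.
have kCs := kC _ s bw.
have M0 : 0 < l * ce s w by rewrite mulr_gt0// ce_gt0.
have N0 := ce_gt0 _ s bv.
(* With [c] the current and [m] the continuation part, the last summand is nonnegative for [p < 0]
   and nonpositive for [p > 0]: [1 - a] has the sign of [p], and [kCs] makes the other factor
   nonpositive. *)
have bwE c m : w s `^ p = c + m ->
    b * w s `^ p = c + a * m + (1 - a) * (k * w s `^ p - c).
  by move=> wE; rewrite /b mulrDl wE; ring.
case: p_sign => p0.
- apply: le_powRV_neg; rewrite ?mulr_gt0 ?powR_gt0//.
  have a1 : 1 < a by rewrite -(powR1r p) ltr_neg_powR ?posrE.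
  rewrite (bwE _ _ (wpE s)) vpE -addrA lerD2l ler_wpDr//.
    by rewrite nmulr_rge0 ?subr_le0 ?subr_lt0.
  rewrite mulrCA; apply: ler_wpM2l => //; rewrite -lceM.
  exact: (le_powR_neg _ _ p0 N0 M0 (le_ce s)).
- apply: le_powRV_pos; rewrite ?mulr_gt0 ?powR_gt0//.
  have a1 : a < 1 by rewrite -(powR1r p) ltr_pos_powR ?posrE.
  rewrite (bwE _ _ (wpE s)) vpE -addrA lerD2l ler_wnDr//.
    by rewrite pmulr_rle0 ?subr_le0 ?subr_gt0.
  rewrite mulrCA; apply: ler_wpM2l => //; rewrite -lceM.
  exact: (le_powR_pos _ _ p0 M0 N0 (le_ce s)).
Qed.

Lemma le_fixpoint v w : bu v -> bu w -> v =1 T v -> w =1 T w ->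
  forall s, w s <= v s.
Proof.
move=> bv bw vT wT.
pose E : set R := [set l | 0 < l <= 1 /\ forall s, l * w s <= v s].
(* The ratio [eps / B] works because [w] is at most [B] and [v] at least [eps]; the minimum enforces
   [l <= 1]. *)
have E0 : E (Num.min (eps / B) 1).
  split; first by rewrite lt_min divr_gt0// ltr01 ge_min lexx orbT.
  move=> s; have /andP[v1 v2] := bv.2 s; have /andP[w1 w2] := bw.2 s.
  apply: le_trans v1; apply: (@le_trans _ _ (eps / B * w s)).
    by rewrite ler_wpM2r ?ge_min ?lexx// ltW// (bu_gt0 _ _ bw).
  by rewrite mulrAC ler_pdivrMr// ler_wpM2l// ltW.
have ubE : ubound E 1 by move=> l [/andP[]].
have hE : has_sup E by split; [exists (Num.min (eps / B) 1)|exists 1].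
(* The supremum is attained: for each [s] the condition reads [l <= v s / w s], which passes to
   suprema. *)
have supE : E (sup E).
  split.
    apply/andP; split; last exact: ge_sup hE.1 ubE.
    case: (E0) => /andP[h _] _; apply: (lt_le_trans h).
    exact: ub_le_sup hE.2 _ E0.
  move=> s; have w0 := bu_gt0 _ s bw; rewrite -ler_pdivlMr//.
  by apply: ge_sup hE.1 _ => l [_ /(_ s)]; rewrite ler_pdivlMr.
have [/andP[L0 L1] Lwv] := supE.
have [L1'|L1'] := ltP (sup E) 1; last first.
  move=> s; apply: le_trans (Lwv s); rewrite ler_peMl// ltW//.
  exact: bu_gt0 bw.
have L01 : 0 < sup E < 1 by rewrite L0.
have [l' /andP[l1 l2] l'wv] := improve_ratio _ _ _ bv bw vT wT L01 Lwv.
(* The improved ratio is again in [E], contradicting maximality. *)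
suff : l' <= sup E by rewrite leNgt l1.
by apply: ub_le_sup hE.2 _ _; split=> //; rewrite l2 (lt_trans L0).
Qed.

Lemma fixpoint_unique v w : bu v -> bu w -> v =1 T v -> w =1 T w -> v = w.
Proof.
move=> bv bw vT wT; apply/funext => s; apply/eqP; rewrite eq_le.
by rewrite (le_fixpoint _ _ bw bv)// (le_fixpoint _ _ bv bw).
Qed.

End koopmans.

Theorem theorem5 (R : realType) (dS dA : measure_display)
    (S : measurableType dS) (A : measurableType dA)
    (hS : borel_space R S) (hA : borel_space R A)
    (K : set (S * A)) (mK : measurable K) (K0 : K !=set0)
    (Ks : forall s : S, xsection K s !=set0)
    (q : S * A -> probability S R) (hq : transition_probability K q)
    (u : S * A -> R) (mu : measurable_fun K u)
    (b0 b1 : R) (b0_gt0 : 0 < b0) (b01 : b0 < b1)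
    (hu : forall k : S * A, K k -> b0 <= u k <= b1)
    (beta r p : R) (hbeta : 0 <= beta < 1) (hr : r < 0)
    (hp1 : p < 1) (hp0 : p != 0)
    (eps B : R) (eps_gt0 : 0 < eps) (epsB : eps < B)
    (hneg : p < 0 -> eps <= b0 /\ (1 - beta) `^ p^-1 * b1 <= B)
    (hpos : 0 < p -> eps <= (1 - beta) `^ p^-1 * b0 /\ b1 <= B)
    (f : S -> A) (hf : stationary_policies K f) :
  [/\ bounded_utilities eps B (recursive_utility q u beta r p f),
      forall s : S, recursive_utility q u beta r p f s =
        koopmans q u beta r p f (recursive_utility q u beta r p f) s &
      forall v : S -> R, bounded_utilities eps B v ->
        (forall s : S, v s = koopmans q u beta r p f v s) ->
        v = recursive_utility q u beta r p f].
Proof.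
have [mf Kf'] := hf.
(* The graph of [f] lies in [K], so the assumptions on [K] become assumptions on all of [S], as the
   results on the operator require. *)
have Kf s : K (s, f s) by have := Kf' s; rewrite /xsection/= inE.
have B_gt0 : 0 < B by exact: lt_trans epsB.
have mq E : measurable E -> measurable_fun [set: S] (fun s => q (s, f s) E).
  move=> mE; apply: (measurable_fun_graph K f (fun k => q k E) mK mf Kf).
  exact: hq.
have muf : measurable_fun [set: S] (fun s => u (s, f s)).
  exact: (measurable_fun_graph K f u mK mf Kf mu).
have uf s : b0 <= u (s, f s) <= b1 by exact: hu.
have Ubnd := recursive_utility_bounded q u _ _ _ f _ _ _ _
  hbeta hr hp0 b0_gt0 eps_gt0 B_gt0 mq muf uf hneg hpos.
have Ufix := recursive_utility_fixpoint q u _ _ _ f _ _ _ _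
  hbeta hr hp0 b0_gt0 eps_gt0 B_gt0 mq muf uf hneg hpos.
split=> // v bv vT.
exact: (fixpoint_unique q u _ _ _ f _ _ _ _
  hbeta hr hp0 b0_gt0 eps_gt0 B_gt0 uf _ _ bv Ubnd vT Ufix).
Qed.
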